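(* Let $x$ be a nonzero pure quaternion, $x=us$, where $s=|x|$ and $u=x/|x|$. Then for every $n\ge0$ $$P_n(x)=\begin{cases}\dfrac{u^n}{s}H_{n+1}(s), & \text{if } n\text{ is even},\\[2mm] \dfrac{u^n}{s^2}\bigl(sH_{n+1}(s)+H_n(s)\bigr), & \text{if } n\text{ is odd}.\end{cases}$$
   Context: $\mathbb{H}$ denotes the real quaternions; $\Lambda\subset\mathbb{H}$ is the set of pure (imaginary) quaternions $z=x_1\mathbf i+x_2\mathbf j+x_3\mathbf k$, identified with $\mathbb{R}^3$. The measure on $\Lambda$ is $d\mu(z)=(2\pi)^{-3/2}e^{-|z|^2/2}\,dm(z)$, with $m$ Lebesgue measure on $\mathbb{R}^3$. Polynomials are functions on $\Lambda$ of the form $P(z)=\sum_{k=0}^N z^ka_k$, $a_k\in\mathbb{H}$, with scalar product $\langle u,w\rangle=\int_\Lambda \overline{u(z)}w(z)\,d\mu(z)$. $P_n$ ($n\ge0$) denotes the (unique) system of monic polynomials (leading term $z^n$) with $\langle P_k,P_l\rangle=0$ for $k\ne l$. $H_n$ are the monic Hermite polynomials: $H_0=1$, $H_1=x$, $H_{n+1}=xH_n-nH_{n-1}$. *)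

(* Defs.v *)
From HB Require Import structures.
From mathcomp Require Import all_boot all_order all_algebra.
From mathcomp Require Import ring.
From mathcomp Require Import all_classical all_reals all_analysis.
From mathcomp Require Import measurable_realfun.

Set Implicit Arguments.
Unset Strict Implicit.
Unset Printing Implicit Defensive.

Import Order.TTheory GRing.Theory Num.Theory.
Import numFieldNormedType.Exports.

Local Open Scope classical_set_scope.
Local Open Scope ring_scope.

(** Quat a b c d is a + b i + c j + d k. *)
Record quat (R : realType) := Quat { qre : R; qi : R; qj : R; qk : R }.

Section QuatAlgebra.
Context {R : realType}.
Implicit Types p q r : quat R.

Definition quat_to_tuple q := (qre q, qi q, qj q, qk q).
Definition quat_of_tuple (t : R * R * R * R) :=
  Quat t.1.1.1 t.1.1.2 t.1.2 t.2.

Lemma quat_to_tupleK : cancel quat_to_tuple quat_of_tuple.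
Proof. by case. Qed.

HB.instance Definition _ := Choice.copy (quat R) (can_type quat_to_tupleK).

Lemma quat_eqP p q :
  qre p = qre q -> qi p = qi q -> qj p = qj q -> qk p = qk q -> p = q.
Proof. by case: p q => [? ? ? ?] [? ? ? ?] /= -> -> -> ->. Qed.

Definition qzero : quat R := Quat 0 0 0 0.
Definition qopp q := Quat (- qre q) (- qi q) (- qj q) (- qk q).
Definition qadd p q :=
  Quat (qre p + qre q) (qi p + qi q) (qj p + qj q) (qk p + qk q).

Fact qaddA : associative qadd.
Proof. by move=> p q r; apply: quat_eqP => /=; rewrite addrA. Qed.
Fact qaddC : commutative qadd.
Proof. by move=> p q; apply: quat_eqP => /=; rewrite addrC. Qed.
Fact qadd0 : left_id qzero qadd.
Proof. by move=> p; apply: quat_eqP => /=; rewrite add0r. Qed.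
Fact qaddN : left_inverse qzero qopp qadd.
Proof. by move=> p; apply: quat_eqP => /=; rewrite addNr. Qed.

HB.instance Definition _ :=
  GRing.isZmodule.Build (quat R) qaddA qaddC qadd0 qaddN.

Definition qone : quat R := Quat 1 0 0 0.
Definition qmul p q :=
  let: Quat a b c d := p in let: Quat a' b' c' d' := q in
  Quat (a * a' - b * b' - c * c' - d * d')
       (a * b' + b * a' + c * d' - d * c')
       (a * c' - b * d' + c * a' + d * b')
       (a * d' + b * c' - c * b' + d * a').

Fact qmulA : associative qmul.
Proof. by case=> ? ? ? ? [? ? ? ?] [? ? ? ?]; apply: quat_eqP => /=; ring. Qed.
Fact qmul1l : left_id qone qmul.
Proof. by case=> ? ? ? ?; apply: quat_eqP => /=; ring. Qed.
Fact qmul1r : right_id qone qmul.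
Proof. by case=> ? ? ? ?; apply: quat_eqP => /=; ring. Qed.
Fact qmulDl : left_distributive qmul (@GRing.add (quat R)).
Proof. by case=> ? ? ? ? [? ? ? ?] [? ? ? ?]; apply: quat_eqP => /=; ring. Qed.
Fact qmulDr : right_distributive qmul (@GRing.add (quat R)).
Proof. by case=> ? ? ? ? [? ? ? ?] [? ? ? ?]; apply: quat_eqP => /=; ring. Qed.
Fact qone_neq0 : qone != 0.
Proof. by apply/eqP => -[] /eqP; rewrite oner_eq0. Qed.

HB.instance Definition _ := GRing.Zmodule_isNzRing.Build (quat R)
  qmulA qmul1l qmul1r qmulDl qmulDr qone_neq0.

Definition qscale (t : R) q := Quat (t * qre q) (t * qi q) (t * qj q) (t * qk q).

Fact qscaleA s t q : qscale s (qscale t q) = qscale (s * t) q.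
Proof. by apply: quat_eqP => /=; rewrite mulrA. Qed.
Fact qscale1 : left_id 1 qscale.
Proof. by move=> q; apply: quat_eqP => /=; rewrite mul1r. Qed.
Fact qscaleDr : right_distributive qscale +%R.
Proof. by move=> t p q; apply: quat_eqP => /=; rewrite mulrDr. Qed.
Fact qscaleDl q : {morph qscale^~ q : s t / s + t}.
Proof. by move=> s t; apply: quat_eqP => /=; rewrite mulrDl. Qed.

HB.instance Definition _ := GRing.Zmodule_isLmodule.Build R (quat R)
  qscaleA qscale1 qscaleDr qscaleDl.

Definition qconj q := Quat (qre q) (- qi q) (- qj q) (- qk q).

Definition qabs q : R :=
  Num.sqrt (qre q ^+ 2 + qi q ^+ 2 + qj q ^+ 2 + qk q ^+ 2).

(** The identification of R^3 with the pure quaternions. *)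
Definition pureq (x : R * R * R) : quat R := Quat 0 x.1.1 x.1.2 x.2.

End QuatAlgebra.

(** [measurableTypeR R] is R with its Borel sigma-algebra. *)
Local Notation R3 R :=
  (measurableTypeR R * measurableTypeR R * measurableTypeR R)%type.

Definition lebesgue3 {R : realType} : {measure set (R3 R) -> \bar R} :=
  ((lebesgue_measure \x lebesgue_measure) \x lebesgue_measure)%E.

Section GaussianMeasure.
Context {R : realType}.

Definition gauss3_pdf (z : R3 R) : R :=
  (2 * pi) `^ (- (3 / 2)) * expR (- (qabs (pureq z) ^+ 2 / 2)).

Definition gauss3 (A : set (R3 R)) : \bar R :=
  \int[lebesgue3]_(z in A) (gauss3_pdf z)%:E.

Lemma gauss3_pdf_ge0 z : 0 <= gauss3_pdf z.
Proof. by rewrite mulr_ge0 ?powR_ge0 ?expR_ge0. Qed.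

Lemma measurable_gauss3_pdf : measurable_fun setT gauss3_pdf.
Proof.
apply: measurable_funM => //; apply: measurableT_comp => //.
have -> : (fun z : R3 R => - (qabs (pureq z) ^+ 2 / 2)) =
    (fun z => - ((z.1.1 ^+ 2 + z.1.2 ^+ 2 + z.2 ^+ 2) / 2)).
  apply/funext => z; rewrite /qabs /= expr0n add0r sqr_sqrtr//.
  by rewrite !addr_ge0 ?sqr_ge0.
apply: measurableT_comp => //; apply: measurable_funM => //.
have m11 : measurable_fun setT (fun z : R3 R => z.1.1).
  exact: (measurableT_comp measurable_fst measurable_fst).
have m12 : measurable_fun setT (fun z : R3 R => z.1.2).
  exact: (measurableT_comp measurable_snd measurable_fst).
by apply: measurable_funD; [apply: measurable_funD|]; apply: measurable_funX.
Qed.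

Let gauss3_0 : gauss3 set0 = 0%E.
Proof. by rewrite /gauss3 integral_set0. Qed.

Let gauss3_ge0 A : (0 <= gauss3 A)%E.
Proof. by apply: integral_ge0 => z _; rewrite lee_fin gauss3_pdf_ge0. Qed.

Let gauss3_sigma_additive : semi_sigma_additive gauss3.
Proof.
apply: semi_sigma_additive_nng_induced.
- by apply/measurable_EFinP; exact: measurable_gauss3_pdf.
- by move=> z; rewrite lee_fin gauss3_pdf_ge0.
Qed.

HB.instance Definition _ := isMeasure.Build _ _ _
  gauss3 gauss3_0 gauss3_ge0 gauss3_sigma_additive.

End GaussianMeasure.

Section QuatPolynomials.
Context {R : realType}.
Implicit Types f g : R * R * R -> quat R.

(** Componentwise integral of a quaternion-valued function. *)
Definition qintegral f : quat R :=
  Quat (\int[gauss3]_z qre (f z)) (\int[gauss3]_z qi (f z))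
       (\int[gauss3]_z qj (f z)) (\int[gauss3]_z qk (f z)).

Definition qdot f g : quat R := qintegral (fun z => qconj (f z) * g z).

(** f is z |-> z^n + \sum_(k < n) z^k a_k; the coefficients are on the right,
    whereas the evaluation of a [{poly quat R}] has them on the left. *)
Definition monic_qpoly (n : nat) f : Prop :=
  exists a : nat -> quat R, forall z,
    f z = pureq z ^+ n + \sum_(k < n) pureq z ^+ k * a k.

Definition monic_orthogonal_system (P : nat -> R * R * R -> quat R) : Prop :=
  (forall n, monic_qpoly n (P n)) /\
  (forall k l, k <> l -> qdot (P k) (P l) = 0).

End QuatPolynomials.

Fixpoint hermite (R : realType) (n : nat) : {poly R} :=
  match n with
  | 0 => 1
  | n'.+1 => match n' with
             | 0 => 'X
             | m.+1 => 'X * hermite R n' - n'%:R *: hermite R m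
             end
  end.

(* Main.v *)
Require Import Defs.
From HB Require Import structures.
From mathcomp Require Import all_boot all_order all_algebra.
From mathcomp Require Import ring lra zify.
From mathcomp Require Import all_classical all_reals all_analysis.
From mathcomp Require Import measurable_realfun.

Set Implicit Arguments.
Unset Strict Implicit.
Unset Printing Implicit Defensive.

Import Order.TTheory GRing.Theory Num.Theory.
Import numFieldNormedType.Exports.

Local Open Scope classical_set_scope.
Local Open Scope ring_scope.

(** Write [z] for a pure quaternion. Since [qconj z = - z], multiplication by [z]
    is skew for the scalar product and the monic orthogonal polynomials satisfy a
    recurrence [Q_(n+2) = z Q_(n+1) + c_(n+1) Q_n] with [c_n = n] for even [n] and
    [c_n = n + 2] for odd [n] (generalised Hermite polynomials). All scalar products
    reduce to the numbers [W n k], the mean of [z^k Q_n], which inherit the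
    recurrence. Starting from the moments [E |z|^(2m) = 3 * 5 * ... * (2m + 1)] it
    solves to a closed form in which a falling factorial gives [W n k = 0] for
    [k < n] and [W n n <> 0]. Hence the [Q_n] are orthogonal, and they are the only
    monic orthogonal system because the matrix [W k j] is triangular with nonzero
    diagonal. On [z = s u] with [u^2 = -1] the recurrence of the [Q_n] is the one
    satisfied by the expressions in [H_n] and [H_(n+1)]. *)

(** * Moments of the Gaussian measures *)

Section NormalMoments.
Context {R : realType}.
Local Notation mu := (@lebesgue_measure R).
Local Notation w := (normal_pdf (0 : R) 1).

Lemma normal_pdf01E x :
  w x = normal_peak 1 * expR (- (x ^+ 2 / 2)).
Proof. by rewrite normal_pdfE ?oner_neq0// /normal_fun subr0 expr1n mulNr. Qed.

Lemma normal_pdf01N x : w (- x) = w x.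
Proof. by rewrite !normal_pdf01E sqrrN. Qed.

Lemma is_derive_normal_pdf01 x : is_derive x (1 : R) w (- (x * w x)).
Proof.
have -> : w = fun x => normal_peak 1 * expR (- (x ^+ 2 / 2)).
  by apply/funext => y; exact: normal_pdf01E.
by apply: is_derive_eq => /=; rewrite /GRing.scale /=; field.
Qed.

Lemma measurable_exprM_normal_pdf01 n :
  measurable_fun setT (fun x : R => x ^+ n * w x).
Proof.
by apply: measurable_funM; [exact: measurable_funX|exact: measurable_normal_pdf].
Qed.

(** Disposes of the boundary terms below. The exponential series gives exp(t^2/2) >= (t^2/2)^(n+1) /
    (n+1)!, so for t >= 1 the product t^n w(t) is at most a constant over t. *)
Lemma cvgn_expr_normal_pdf01 n : k%:R ^+ n * w k%:R @[k --> \oo] --> (0 : R).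
Proof.
rewrite -cvg_shiftS /=.
pose C : R := normal_peak 1 * (n.+1`!%:R * 2 ^+ n.+1).
have C0 : 0 <= C by rewrite !mulr_ge0 ?normal_peak_ge0// exprn_ge0.
apply: (@squeeze_cvgr _ _ _ _ (cst 0) (C \*o harmonic)).
- near=> k; rewrite mulr_ge0 ?exprn_ge0 ?normal_pdf_ge0//=.
  set t : R := k.+1%:R; have t1 : 1 <= t by rewrite ler1n.
  have t0 : 0 < t by exact: lt_le_trans t1.
  have := @expR_ge1Dxn R (t ^+ 2 / 2) n (divr_ge0 (sqr_ge0 _) (ler0n _ 2)).
  move/(le_trans (ler_wpDl ler01 (lexx _))).
  rewrite ler_pdivrMr ?ltr0n ?fact_gt0// exprMn exprVn ler_pdivrMr ?exprn_gt0//.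
  move=> tE.
  rewrite -/t.
  rewrite normal_pdf01E mulrCA -[leRHS]mulrA ler_wpM2l ?normal_peak_ge0//.
  rewrite expRN ler_pdivrMr ?expR_gt0// mulrAC ler_pdivlMr// -exprSr.
  rewrite [leRHS]mulrC mulrA (le_trans _ tE)// -exprM ler_weXn2l//.
  by rewrite leq_pmull.
- exact: cvg_cst.
- rewrite -[X in _ --> X](mulr0 C); apply: cvgMr; exact: cvg_harmonic.
Unshelve. all: by end_near.
Qed.

(** Integration by parts of x^(n+1) against x w(x), which has the primitive -w. *)
Lemma integral_itv_normal_pdf01 n (b : R) : 0 < b ->
  (\int[mu]_(x in `[(- b)%R, b]) (x ^+ n.+2 * w x)%:E =
   (- ((b ^+ n.+1 - (- b) ^+ n.+1) * w b))%:E
   + n.+1%:R%:E * \int[mu]_(x in `[(- b)%R, b]) (x ^+ n * w x)%:E)%E.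
Proof.
move=> b0.
have cX k : continuous (fun x : R => x ^+ k) by exact: exprn_continuous.
have cw : continuous w by apply: continuous_normal_pdf; rewrite oner_neq0.
have dw (x : R) : derivable w x 1 by have [] := is_derive_normal_pdf01 x.
have bb : - b < b by lra.
have := @integration_by_parts R (fun x => x ^+ n.+1) (fun x => - w x)
  (fun x => n.+1%:R * x ^+ n) (fun x => x * w x) (- b) b bb.
have -> : (fun x : R => (x ^+ n.+1 * (x * w x))%:E) =
  (fun x : R => (x ^+ n.+2 * w x)%:E).
  by apply/funext => x; rewrite mulrA -exprSr.
move=> ->.
- rewrite normal_pdf01N; congr (_%:E + _)%E; first by ring.
  under eq_integral do rewrite mulrN -mulrA -mulNr EFinM.
  rewrite integralZl//; first by rewrite EFinN mulNe oppeK.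
  apply: continuous_compact_integrable; first exact: segment_compact.
  by apply: continuous_subspaceT => x; apply: cvgM; [exact: cX|exact: cw].
- apply: continuous_subspaceT => x; apply: cvgM; [exact: cvg_cst|exact: cX].
- split => [x _||].
  + exact: exprn_derivable.
  + exact: cvg_at_right_filter (cX _ _).
  + exact: cvg_at_left_filter (cX _ _).
- by move=> x _; rewrite exp_derive1.
- apply: continuous_subspaceT => x; apply: cvgM; [exact: cvg_id|exact: cw].
- split => [x _||].
  + exact: derivableN.
  + apply: cvgN; exact: cvg_at_right_filter (cw _).
  + apply: cvgN; exact: cvg_at_left_filter (cw _).
- move=> x _; rewrite derive1E deriveN// .
  by have H := is_derive_normal_pdf01 x; rewrite derive_val opprK.
Qed.

(* Only even powers: on nonnegative integrands the integrals over [-i, i] converge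
   to the full one in the extended reals, so integrability need not be
   known yet. *)
Lemma integral_expr_double_normal_pdf01 k :
  (\int[mu]_x (x ^+ k.*2.+2 * w x)%:E =
   k.*2.+1%:R%:E * \int[mu]_x (x ^+ k.*2 * w x)%:E)%E.
Proof.
pose F (i : nat) := `[(- i%:R : R), i%:R]%classic.
have FT : \bigcup_i F i = [set: R].
  apply/seteqP; split=> // x _; exists (Num.trunc `|x|).+1 => //=.
  rewrite /F /= in_itv /= -ler_norml ltW// truncnS_gt//.
have ndF : nondecreasing_seq F.
  move=> i j ij; apply/subsetPset/subset_itv; rewrite bnd_simp ?lerN2 ler_nat//.
have cvI m : (\int[mu]_(x in F i) (x ^+ m.*2 * w x)%:E @[i --> \oo] -->
    \int[mu]_x (x ^+ m.*2 * w x)%:E)%E.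
  rewrite -FT; apply: ge0_nondecreasing_set_cvg_integral => //.
  - by move=> i; exact: measurable_itv.
  - move=> i; apply: measurable_funTS; apply/measurable_EFinP.
    exact: measurable_exprM_normal_pdf01.
  - by move=> i x _; rewrite lee_fin mulr_ge0 ?normal_pdf_ge0// -mul2n exprM
    exprn_ge0 ?sqr_ge0.
pose I m i : \bar R := (\int[mu]_(x in F i) (x ^+ m.*2 * w x)%:E)%E.
pose B (i : nat) : R :=
  - ((i.+1%:R ^+ k.*2.+1 - (- i.+1%:R) ^+ k.*2.+1) * w i.+1%:R).
(* The index is shifted because the integration by parts needs an interval of positive length. *)
have IS : (fun i => I k.+1 i.+1) =
    (fun i => (B i)%:E + k.*2.+1%:R%:E * I k i.+1)%E.
  by apply/funext => i; rewrite /I /F integral_itv_normal_pdf01.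
have B0 : B i @[i --> \oo] --> (0 : R).
  (* The exponent is odd, so the contributions of the two endpoints add up. *)
  have -> : B = fun i => - 2 * (i.+1%:R ^+ k.*2.+1 * w i.+1%:R).
    by apply/funext => i; rewrite /B exprNn -signr_odd /= odd_double/= expr1;
      ring.
  rewrite -[X in _ --> X](mulr0 (- 2)); apply: cvgMr.
  by have := @cvgn_expr_normal_pdf01 k.*2.+1; rewrite -cvg_shiftS.
have : I k.+1 i.+1 @[i --> \oo] -->
    (0%:E + k.*2.+1%:R%:E * \int[mu]_x (x ^+ k.*2 * w x)%:E)%E.
  rewrite IS; apply: cvgeD.
  - exact: fin_num_adde_defr.
  - by apply/cvg_EFin; [exact: nearW|exact: B0].
  - apply: cvgeZl => //.
    by have := cvI k; rewrite -cvg_shiftS.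
by rewrite add0e; have := cvI k.+1; rewrite -cvg_shiftS => /cvg_unique/[apply];
  exact.
Qed.
End NormalMoments.

(** * Integrals with integrability attached *)

Section HasIntegral.
Context d (T : measurableType d) (R : realType).
Variable mu : {measure set T -> \bar R}.
Implicit Types (f g : T -> R) (u v : R).

(** Integrability travels with the value, so sums and multiples can be computed without separate
    integrability conditions. *)
Definition has_integral f v :=
  mu.-integrable setT (EFin \o f) /\ (\int[mu]_x (f x)%:E = v%:E)%E.

Lemma has_integral_Rintegral f v : has_integral f v -> \int[mu]_x f x = v.
Proof. by case=> _; rewrite /Rintegral => ->. Qed.

Lemma has_integral0 : has_integral (fun=> 0) 0.
Proof. by split; [exact: integrable0|exact: integral0]. Qed.

Lemma has_integralD f g u v : has_integral f u -> has_integral g v ->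
  has_integral (fun x => f x + g x) (u + v).
Proof.
move=> [fi fu] [gi gv]; split; first exact: (integrableD measurableT fi gi).
by under eq_integral do rewrite EFinD; rewrite (integralD _ fi gi)//= fu gv.
Qed.

Lemma has_integralZ f u v : has_integral f v ->
  has_integral (fun x => u * f x) (u * v).
Proof.
move=> [fi fv]; split; first exact: (integrableZl _ _ fi).
by under eq_integral do rewrite EFinM; rewrite (integralZl _ fi)// fv.
Qed.

Lemma has_integralZr f u v : has_integral f v ->
  has_integral (fun x => f x * u) (v * u).
Proof.
by rewrite mulrC; under eq_fun do rewrite mulrC; exact: has_integralZ.
Qed.

Lemma has_integralN f v : has_integral f v ->
  has_integral (fun x => - f x) (- v).
Proof.
by move=> /(has_integralZ (-1)); under eq_fun do rewrite mulN1r; rewrite mulN1r.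
Qed.

Lemma has_integralB f g u v : has_integral f u -> has_integral g v ->
  has_integral (fun x => f x - g x) (u - v).
Proof. by move=> fu gv; apply: has_integralD => //; exact: has_integralN. Qed.

Lemma has_integral_sum I (s : seq I) (f : I -> T -> R) (v : I -> R) :
  (forall i, has_integral (f i) (v i)) ->
  has_integral (fun x => \sum_(i <- s) f i x) (\sum_(i <- s) v i).
Proof.
move=> fv; elim: s => [|i s IHs].
  by rewrite big_nil; under eq_fun do rewrite big_nil; exact: has_integral0.
by rewrite big_cons; under eq_fun do rewrite big_cons; exact: has_integralD.
Qed.

Lemma ge0_has_integral f v : measurable_fun setT f -> (forall x, 0 <= f x) ->
  (\int[mu]_x (f x)%:E = v%:E)%E -> has_integral f v.
Proof.
move=> mf f0 fv; split=> //; apply/integrableP; split.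
  exact/measurable_EFinP.
under eq_integral do rewrite /= ger0_norm//.
by rewrite fv ltry.
Qed.

End HasIntegral.

(** * Integrals over product spaces *)

Section ProductIntegral.
Context d1 d2 (T1 : measurableType d1) (T2 : measurableType d2) (R : realType).
Variable m1 : {sigma_finite_measure set T1 -> \bar R}.
Variable m2 : {sigma_finite_measure set T2 -> \bar R}.

(** Tonelli applied to the absolute values gives integrability on the product; Fubini then separates
    the factors. *)
Lemma has_integral_prod (f : T1 -> R) (g : T2 -> R) (u v : R) :
  has_integral m1 f u -> has_integral m2 g v ->
  has_integral (m1 \x m2)%E (fun z => f z.1 * g z.2) (u * v).
Proof.
move=> [fi fu] [gi gv].
have mf : measurable_fun setT f by apply/measurable_EFinP; case/integrableP: fi.
have mg : measurable_fun setT g by apply/measurable_EFinP; case/integrableP: gi.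
have mfg : measurable_fun setT (fun z : T1 * T2 => f z.1 * g z.2).
  by apply: measurable_funM; apply: measurableT_comp.
have fgi : (m1 \x m2)%E.-integrable setT (EFin \o (fun z => f z.1 * g z.2)).
  apply/integrable12ltyP; first exact/measurable_EFinP.
  have gn := integrable_abse gi.
  have fn := integrable_abse fi.
  under eq_integral => x _.
    under eq_integral do rewrite /= normrM EFinM.
    rewrite (integralZl measurableT gn).
    over.
  have gnE : (\int[m2]_x `|g x|%:E)%E \is a fin_num
    by exact: (integrable_fin_num measurableT gn).
  rewrite -(fineK gnE) (integralZr measurableT fn).
  have fnE : (\int[m1]_x `|f x|%:E)%E \is a fin_num
    by exact: (integrable_fin_num measurableT fn).
  by rewrite -(fineK fnE) -EFinM ltry.
split => //.
rewrite -(integral12_prod_meas1 fgi).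
under eq_integral => x _.
  rewrite /fubini_F; under eq_integral do rewrite /= EFinM.
  rewrite (integralZl measurableT gi) /= gv.
  over.
by rewrite (integralZr measurableT fi) /= fu EFinM.
Qed.

End ProductIntegral.

(* The canonical sigma-finite structure that the library declares on [m1 \x m2]
   is shadowed by the one for products of subprobabilities, hence this alias. *)
Section SigmaFiniteProduct.
Context d1 d2 (T1 : measurableType d1) (T2 : measurableType d2) (R : realType).
Variable m1 : {sigma_finite_measure set T1 -> \bar R}.
Variable m2 : {sigma_finite_measure set T2 -> \bar R}.

Definition sigma_finite_prod : set (T1 * T2) -> \bar R := (m1 \x m2)%E.

HB.instance Definition _ := Measure.copy sigma_finite_prod (m1 \x m2)%E.

Let sigma_finite_prodT : sigma_finite setT sigma_finite_prod.
Proof.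
have /sigma_finiteP[F [TF ndF Foo]] := sigma_finiteT m1.
have /sigma_finiteP[G [TG ndG Goo]] := sigma_finiteT m2.
exists (fun n => F n `*` G n).
  apply/seteqP; split=> // -[x y] _.
  have [n _ Fnx] : (\bigcup_i F i) x by rewrite -TF.
  have [k _ Gky] : (\bigcup_i G i) y by rewrite -TG.
  exists (maxn n k) => //; split=> /=.
  - by move: x Fnx; exact/subsetPset/ndF/leq_maxl.
  - by move: y Gky; exact/subsetPset/ndG/leq_maxr.
move=> n; have [mF Ff] := Foo n; have [mG Gf] := Goo n.
split; first exact: measurableX.
by rewrite /sigma_finite_prod /= product_measure1E// lte_mul_pinfty//
  ge0_fin_numE.
Qed.

HB.instance Definition _ :=
  Measure_isSigmaFinite.Build _ _ _ sigma_finite_prod sigma_finite_prodT.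

End SigmaFiniteProduct.

(** * Integration against a density *)

Section Density.
Context d (T : measurableType d) (R : realType).
Variables (mu : {sigma_finite_measure set T -> \bar R})
  (nu : {finite_measure set T -> \bar R}) (w : T -> R).
Hypotheses (mw : measurable_fun setT w) (w0 : forall x, 0 <= w x).
Hypothesis nuE : forall A, measurable A -> nu A = (\int[mu]_(x in A) (w x)%:E)%E.

(** [nu] is dominated by [mu]. Its Radon-Nikodym derivative and [w] have the same integral over
    every measurable set, hence agree almost everywhere, and the change of variables for the
    derivative carries over to [w]. *)
Lemma ge0_integral_density (f : T -> \bar R) : (forall x, 0 <= f x)%E ->
  measurable_fun setT f -> (\int[nu]_x f x = \int[mu]_x (f x * (w x)%:E))%E.
Proof.
move=> f0 mf.
have numu : nu `<< mu.
  apply/null_content_dominatesP => A mA muA0; rewrite nuE//.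
  by apply: null_set_integral => //; apply: measurable_funTS;
    apply/measurable_EFinP.
rewrite -(Radon_Nikodym_SigmaFinite.change_of_variables numu)//.
have RNi := Radon_Nikodym_SigmaFinite.f_integrable numu.
apply: ae_eq_integral => //.
- by apply: emeasurable_funM => //; exact: measurable_int RNi.
- by apply: emeasurable_funM => //; apply/measurable_EFinP.
- apply: ae_eqe_mul2l; apply: integral_ae_eq => //; first exact/measurable_EFinP.
  by move=> E _ mE; rewrite -Radon_Nikodym_SigmaFinite.f_integral// nuE.
Qed.

(** Multiplication by the nonnegative [w] commutes with absolute values and with positive and
    negative parts, which reduces the claim to nonnegative functions. *)
Lemma has_integral_density (f : T -> R) (v : R) : measurable_fun setT f ->
  has_integral mu (fun x => f x * w x) v -> has_integral nu f v.
Proof.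
move=> mf [fwi fwv].
have mfE : measurable_fun setT (EFin \o f) by exact/measurable_EFinP.
split.
  apply/integrableP; split; first exact/measurable_EFinP.
  rewrite ge0_integral_density//; last exact: measurableT_comp.
  move/integrableP : fwi => [_]; congr (_ < _)%E; apply: eq_integral => x _ /=.
  by rewrite normrM (ger0_norm (w0 x)).
rewrite integralE !ge0_integral_density//; last 2 first.
  exact: measurable_funeneg.
  exact: measurable_funepos.
rewrite -fwv [RHS]integralE; congr (_ - _)%E; apply: eq_integral => x _.
  by rewrite !funeposE /= maxe_pMl ?lee_fin// mul0e.
by rewrite !funenegE /= maxe_pMl ?lee_fin// mul0e -EFinM mulNr.
Qed.

End Density.

(** * Moments of the standard normal law *)

Section Moments.
Context {R : realType}.
Local Notation mu := (@lebesgue_measure R).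
Local Notation w := (normal_pdf (0 : R) 1).

(** For a = 1 this is the double factorial (2m-1)!!, the normal moment of order 2m; for a = 2 and a
    = 3 it is the moment of |z|^(2m) in dimension two and three. *)
Definition rising2 (a m : nat) : R := \prod_(i < m) (a + i.*2)%:R.

Lemma rising2S a m : rising2 a m.+1 = rising2 a m * (a + m.*2)%:R.
Proof. by rewrite /rising2 big_ord_recr. Qed.

Lemma rising2_neq0 a m : (0 < a)%N -> rising2 a m != 0.
Proof.
move=> a0; rewrite /rising2 prodf_seq_neq0; apply/allP => i _ /=.
by rewrite pnatr_eq0 -lt0n ltn_addr.
Qed.

(** Pascal's rule in the shape needed for the induction on [m] in the next identity. *)
Lemma sum_pascal m (F : nat -> R) :
  \sum_(k < m.+2) F k *+ 'C(m.+1, k) = \sum_(k < m.+1) (F k + F k.+1) *+ 'C(m, k).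
Proof.
rewrite big_ord_recl /= bin0.
under eq_bigr => i _ do rewrite /bump /= add1n binS mulrnDr.
rewrite big_split /= addrA.
have -> : F 0 *+ 1 + \sum_(i < m.+1) F i.+1 *+ 'C(m, i.+1) =
    \sum_(k < m.+2) F k *+ 'C(m, k).
  by rewrite [RHS]big_ord_recl /= bin0;
    under [in RHS]eq_bigr do rewrite /bump /= add1n.
rewrite big_ord_recr /= bin_small// mulr0n addr0 -big_split /=.
by under eq_bigr do rewrite -mulrnDl.
Qed.

(** A Vandermonde identity: Pascal's rule pairs the terms, and the two new factors a + 2(m-k) and b
    + 2k add up to a + b + 2m. *)
Lemma sum_rising2 a b m :
  \sum_(k < m.+1) (rising2 a (m - k) * rising2 b k) *+ 'C(m, k) =
  rising2 (a + b) m.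
Proof.
elim: m => [|m IHm].
  by rewrite big_ord_recl big_ord0 /= /rising2 !big_ord0 mulr1 addr0.
rewrite (sum_pascal m (fun k => rising2 a (m.+1 - k) * rising2 b k)).
rewrite rising2S -IHm mulr_suml; apply: eq_bigr => k _.
have km : (k <= m)%N by rewrite -ltnS.
rewrite subSS subSn// !rising2S mulrnAl; congr (_ *+ _).
rewrite (_ : (a + b + m.*2)%N = (a + (m - k).*2 + (b + k.*2))%N) ?natrD;
  first by ring.
by lia.
Qed.

Definition normal_moment (n : nat) : R := if odd n then 0 else rising2 1 n./2.

Lemma normal_moment_odd n : odd n -> normal_moment n = 0.
Proof. by rewrite /normal_moment => ->. Qed.

Lemma normal_moment_double n : normal_moment n.*2 = rising2 1 n.
Proof. by rewrite /normal_moment odd_double doubleK. Qed.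

Lemma has_integral_normal_even k :
  has_integral mu (fun x => x ^+ k.*2 * w x) (rising2 1 k).
Proof.
apply: ge0_has_integral; first exact: measurable_exprM_normal_pdf01.
  by move=> x; rewrite mulr_ge0 ?normal_pdf_ge0// -mul2n exprM exprn_ge0 ?sqr_ge0.
elim: k => [|k IHk].
  under eq_integral do rewrite mul1r.
  by rewrite integral_normal_pdf /rising2 big_ord0.
by rewrite doubleS integral_expr_double_normal_pdf01 IHk rising2S -EFinM mulrC
  add1n.
Qed.

Lemma has_integral_normal_odd n : odd n ->
  has_integral mu (fun x => x ^+ n * w x) 0.
Proof.
move=> on.
have mf : measurable_fun setT (fun x : R => (x ^+ n * w x)%:E).
  by apply/measurable_EFinP; exact: measurable_exprM_normal_pdf01.
have fi : mu.-integrable setT (EFin \o (fun x => x ^+ n * w x)).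
  (* Integrability by domination: |x|^n <= 1 + x^(2n), and both even moments are finite. *)
  have [[i0 _] [i1 _]] :=
    (has_integral_normal_even 0, has_integral_normal_even n).
  apply: (le_integrable measurableT _ _ (integrableD measurableT i0 i1)) => //.
  move=> x _ /=; rewrite lee_fin normrM normrX !(ger0_norm
    (normal_pdf_ge0 _ _ _)).
  rewrite expr0 -mulrDl normrM (ger0_norm (normal_pdf_ge0 _ _ _)) ler_wpM2r
    ?normal_pdf_ge0//.
  have x2 : x ^+ n.*2 = `|x| ^+ n ^+ 2
    by rewrite -exprM muln2 -normrX ger0_norm// -mul2n exprM exprn_ge0 ?sqr_ge0.
  rewrite x2; set t := `|x| ^+ n;
    rewrite (@ger0_norm _ (1 + _)) ?addr_ge0 ?sqr_ge0//.
  by have := sqr_ge0 (t - 1); have := normr_ge0 x; nra.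
split=> //.
have If : (\int[mu]_x (x ^+ n * w x)%:E)%E \is a fin_num.
  exact: (integrable_fin_num measurableT fi).
(* Lebesgue measure is invariant under x -> -x and the integrand is odd; being finite and equal to
   its opposite, the integral is zero. *)
have : (\int[mu]_x (x ^+ n * w x)%:E = - \int[mu]_x (x ^+ n * w x)%:E)%E.
  transitivity (\int[pushforward mu (-%R : R -> measurableTypeR R)]_x
      (x ^+ n * w x)%:E)%E.
    by apply: eq_measure_integral => A mA _; exact/esym/lebesgue_measureN.
  have wN x : ((- x) ^+ n * w (- x))%:E = ((- 1)%:E * (x ^+ n * w x)%:E)%E.
    rewrite normal_pdf01N exprNn -signr_odd on /= expr1.
    by rewrite mulN1r mulNr -EFinM mulN1r.
  have Ni := integrableZl measurableT (- 1) fi.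
  rewrite integral_pushforward//=; last first.
    by rewrite preimage_setT /comp; under eq_fun do rewrite wN.
  rewrite preimage_setT; under eq_integral do rewrite wN.
  by rewrite (integralZl measurableT fi) EFinN mulN1e.
rewrite -(fineK If) -EFinN => -[] /eqP;
  rewrite -subr_eq0 opprK -mulr2n mulrn_eq0 /=.
by move=> /eqP ->.
Qed.

Lemma has_integral_normal_moment n :
  has_integral mu (fun x => x ^+ n * w x) (normal_moment n).
Proof.
rewrite /normal_moment; case: ifPn =>
  [/has_integral_normal_odd //|/even_halfK {1}<-].
exact: has_integral_normal_even.
Qed.

End Moments.

(** * Moments of the Gaussian measure on R^3 *)

Section GaussMoments.
Context {R : realType}.
Local Notation mu := (@lebesgue_measure R).
Local Notation w := (normal_pdf (0 : R) 1).
Local Notation R3 :=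
  (measurableTypeR R * measurableTypeR R * measurableTypeR R)%type.
Local Notation M := (@normal_moment R).

Lemma gauss3_pdfE (z : R3) : gauss3_pdf z = w z.1.1 * w z.1.2 * w z.2.
Proof.
rewrite /gauss3_pdf !normal_pdf01E /qabs /= expr0n add0r sqr_sqrtr; last first.
  by rewrite !addr_ge0 ?sqr_ge0.
have -> : (2 * pi : R) `^ (- (3 / 2)) = normal_peak 1 ^+ 3.
  rewrite powRN (mulrC 3) powRrM powR12_sqrt ?mulr_ge0 ?pi_ge0// powR_mulrn
    ?sqrtr_ge0//.
  by rewrite /normal_peak expr1n mul1r exprVn -(mulr_natl pi).
rewrite (_ : - (_ / 2) =
  - (z.1.1 ^+ 2 / 2) + - (z.1.2 ^+ 2 / 2) + - (z.2 ^+ 2 / 2)); last by field.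
by rewrite !expRD; ring.
Qed.

Lemma has_integral_gauss3_pdf_monomial a b c :
  has_integral lebesgue3
    (fun z : R3 => z.1.1 ^+ a * z.1.2 ^+ b * z.2 ^+ c * gauss3_pdf z)
    (M a * M b * M c).
Proof.
have -> : (fun z : R3 => z.1.1 ^+ a * z.1.2 ^+ b * z.2 ^+ c * gauss3_pdf z) =
    (fun z => z.1.1 ^+ a * w z.1.1 * (z.1.2 ^+ b * w z.1.2) * (z.2 ^+ c * w z.2)).
  by apply/funext => z /=; rewrite gauss3_pdfE; ring.
have H1 : has_integral (sigma_finite_prod mu mu)
    (fun z => z.1 ^+ a * w z.1 * (z.2 ^+ b * w z.2)) (M a * M b).
  exact: has_integral_prod (has_integral_normal_moment a)
    (has_integral_normal_moment b).
exact: has_integral_prod H1 (has_integral_normal_moment c).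
Qed.

(** The monomial of degree zero. It makes [gauss3] a probability, thus a finite measure, as
    integration against a density requires. *)
Lemma gauss3_setT : gauss3 [set: R3] = 1%E.
Proof.
have [_] := has_integral_gauss3_pdf_monomial 0 0 0.
rewrite /normal_moment /= /rising2 !big_ord0 !mulr1 => <-.
by apply: eq_integral => z _; rewrite ?expr0 !mul1r.
Qed.

HB.instance Definition _ := @Measure_isProbability.Build _ _ R gauss3 gauss3_setT.

Lemma has_integral_gauss3_monomial a b c :
  has_integral gauss3 (fun z : R3 => z.1.1 ^+ a * z.1.2 ^+ b * z.2 ^+ c)
    (M a * M b * M c).
Proof.
apply: (has_integral_density (w := gauss3_pdf)
  (mu := sigma_finite_prod (sigma_finite_prod mu mu) mu)).
- exact: measurable_gauss3_pdf.
- exact: gauss3_pdf_ge0.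
- by [].
- have m11 : measurable_fun setT (fun z : R3 => z.1.1).
    exact: (measurableT_comp measurable_fst measurable_fst).
  have m12 : measurable_fun setT (fun z : R3 => z.1.2).
    exact: (measurableT_comp measurable_snd measurable_fst).
  by apply: measurable_funM; [apply: measurable_funM|]; apply: measurable_funX.
- exact: has_integral_gauss3_pdf_monomial.
Qed.

(** The binomial theorem is applied twice: [i] counts the factors from the third coordinate, [j]
    those from the second. *)
Lemma has_integral_gauss3_monomial_norm a b c m :
  has_integral gauss3 (fun z : R3 => z.1.1 ^+ a * z.1.2 ^+ b * z.2 ^+ c *
      (z.1.1 ^+ 2 + z.1.2 ^+ 2 + z.2 ^+ 2) ^+ m)
    (\sum_(i < m.+1) \sum_(j < (m - i).+1) ('C(m, i) * 'C(m - i, j))%:R *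
      (M (a + (m - i - j).*2) * M (b + j.*2) * M (c + i.*2))).
Proof.
have -> : (fun z : R3 => z.1.1 ^+ a * z.1.2 ^+ b * z.2 ^+ c *
      (z.1.1 ^+ 2 + z.1.2 ^+ 2 + z.2 ^+ 2) ^+ m) =
   (fun z => \sum_(i < m.+1) \sum_(j < (m - i).+1) ('C(m, i) * 'C(m - i, j))%:R *
     (z.1.1 ^+ (a + (m - i - j).*2) * z.1.2 ^+ (b + j.*2) * z.2 ^+ (c + i.*2))).
  apply/funext => z; rewrite exprDn mulr_sumr; apply: eq_bigr => i _.
  rewrite exprDn -(mulr_natl _ 'C(m, i)) mulr_suml !mulr_sumr.
  apply: eq_bigr => j _; rewrite -(mulr_natl _ 'C(m - i, j)) -!exprM !mul2n
    natrM !exprD.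
  by ring.
apply: has_integral_sum => i; apply: has_integral_sum => j; apply: has_integralZ.
exact: has_integral_gauss3_monomial.
Qed.

(** The expansion of |z|^(2m) adds only even exponents, so every term keeps an odd one-dimensional
    moment. *)
Lemma has_integral_gauss3_odd a b c m : [|| odd a, odd b | odd c] ->
  has_integral gauss3 (fun z : R3 => z.1.1 ^+ a * z.1.2 ^+ b * z.2 ^+ c *
      (z.1.1 ^+ 2 + z.1.2 ^+ 2 + z.2 ^+ 2) ^+ m) 0.
Proof.
move=> oabc.
have := has_integral_gauss3_monomial_norm a b c m.
rewrite big1// => i _; rewrite big1// => j _.
have oD n k : odd n -> M (n + k.*2) = 0.
  by move=> on; rewrite normal_moment_odd// oddD odd_double on.
by case/or3P: oabc => o; rewrite !(oD _ _ o) ?(mul0r, mulr0).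
Qed.

(** The double sum collapses by two Vandermonde identities, from parameters 1 + 1 to 2 and from 2 +
    1 to 3. *)
Lemma has_integral_gauss3_norm m :
  has_integral gauss3 (fun z : R3 => (z.1.1 ^+ 2 + z.1.2 ^+ 2 + z.2 ^+ 2) ^+ m)
    (rising2 3 m).
Proof.
have := has_integral_gauss3_monomial_norm 0 0 0 m.
under eq_fun do rewrite ?expr0 !mul1r.
rewrite [X in has_integral _ _ X](_ : _ = rising2 3 m)// -(sum_rising2 2 1).
apply: eq_bigr => i _; rewrite -(sum_rising2 1 1) mulr_suml -sumrMnl.
apply: eq_bigr => j _; rewrite !add0n !normal_moment_double natrM.
by rewrite -mulrA !mulr_natl mulrnAl mulrAC.
Qed.

End GaussMoments.

(** * Quaternion-valued integrals *)

Section QuaternionAlgebra.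
Context {R : realType}.
Implicit Types (p q : quat R) (t : R) (z : R * R * R).

Lemma qscaleAl t p q : (t *: p) * q = t *: (p * q).
Proof. by case: p q => [? ? ? ?] [? ? ? ?]; apply: quat_eqP => /=; ring. Qed.

Lemma qscaleAr t p q : p * (t *: q) = t *: (p * q).
Proof. by case: p q => [? ? ? ?] [? ? ? ?]; apply: quat_eqP => /=; ring. Qed.

(** The multiplication matches on constructors; this form in projections can be rewritten under an
    integral. *)
Lemma quat_mulE p q : p * q = Quat
  (qre p * qre q - qi p * qi q - qj p * qj q - qk p * qk q)
  (qre p * qi q + qi p * qre q + qj p * qk q - qk p * qj q)
  (qre p * qj q - qi p * qk q + qj p * qre q + qk p * qi q)
  (qre p * qk q + qi p * qj q - qj p * qi q + qk p * qre q).
Proof. by case: p q => [? ? ? ?] [? ? ? ?]. Qed.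

Lemma qconjM p q : qconj (p * q) = qconj q * qconj p.
Proof. by case: p q => [? ? ? ?] [? ? ? ?]; apply: quat_eqP => /=; ring. Qed.

Lemma qconjD p q : qconj (p + q) = qconj p + qconj q.
Proof. by case: p q => [? ? ? ?] [? ? ? ?]; apply: quat_eqP => /=; ring. Qed.

Lemma qconjZ t p : qconj (t *: p) = t *: qconj p.
Proof. by case: p => [? ? ? ?]; apply: quat_eqP => /=; ring. Qed.

Lemma qconj1 : qconj 1 = 1 :> quat R.
Proof. by apply: quat_eqP => /=; ring. Qed.

Lemma qconj_pureq z : qconj (pureq z) = - pureq z.
Proof. by apply: quat_eqP => /=; ring. Qed.

Lemma qconj_pureqX z k : qconj (pureq z ^+ k) = (-1) ^+ k *: pureq z ^+ k.
Proof.
elim: k => [|k IHk]; first by rewrite !expr0 scale1r qconj1.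
by rewrite [in LHS]exprS qconjM IHk qconj_pureq qscaleAl mulrN -exprSr
  [in RHS]exprS mulN1r scaleNr scalerN.
Qed.

Lemma pureqX2 z :
  pureq z ^+ 2 = (- (z.1.1 ^+ 2 + z.1.2 ^+ 2 + z.2 ^+ 2)) *: (1 : quat R).
Proof. by rewrite expr2; apply: quat_eqP => /=; ring. Qed.

Lemma qscale1X t k : (t *: (1 : quat R)) ^+ k = t ^+ k *: (1 : quat R).
Proof.
elim: k => [|k IHk]; first by rewrite !expr0 scale1r.
by rewrite !exprS IHk qscaleAl mul1r scalerA.
Qed.

Lemma pureqX_double z m : pureq z ^+ m.*2 =
  ((-1) ^+ m * (z.1.1 ^+ 2 + z.1.2 ^+ 2 + z.2 ^+ 2) ^+ m) *: (1 : quat R).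
Proof. by rewrite -mul2n exprM pureqX2 qscale1X; congr (_ *: _); exact: exprNn.
Qed.

Lemma pureqX_doubleS z m : pureq z ^+ m.*2.+1 =
  ((-1) ^+ m * (z.1.1 ^+ 2 + z.1.2 ^+ 2 + z.2 ^+ 2) ^+ m) *: pureq z.
Proof. by rewrite exprSr pureqX_double qscaleAl mul1r. Qed.

End QuaternionAlgebra.

Section QuaternionMeans.
Context {R : realType}.
Implicit Types (f g : R * R * R -> quat R) (p q : quat R).
Local Notation R3 :=
  (measurableTypeR R * measurableTypeR R * measurableTypeR R)%type.

Definition has_qintegral f q := [/\
  has_integral gauss3 (fun z : R3 => qre (f z)) (qre q),
  has_integral gauss3 (fun z : R3 => qi (f z)) (qi q),
  has_integral gauss3 (fun z : R3 => qj (f z)) (qj q) &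
  has_integral gauss3 (fun z : R3 => qk (f z)) (qk q)].

Lemma has_qintegralE f q : has_qintegral f q -> qintegral f = q.
Proof.
by case=> f0 f1 f2 f3; apply: quat_eqP => /=; exact: has_integral_Rintegral.
Qed.

Lemma has_qintegral0 : has_qintegral (fun=> 0) 0.
Proof. by split; exact: has_integral0. Qed.

Lemma has_qintegralD f g p q : has_qintegral f p -> has_qintegral g q ->
  has_qintegral (fun z => f z + g z) (p + q).
Proof. by move=> [? ? ? ?] [? ? ? ?]; split; exact: has_integralD. Qed.

Lemma has_qintegral_sum n (f : 'I_n -> R * R * R -> quat R) (q : 'I_n -> quat R) :
  (forall i, has_qintegral (f i) (q i)) ->
  has_qintegral (fun z => \sum_i f i z) (\sum_i q i).
Proof.
move=> fq; elim: (index_enum _) => [|i s IHs].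
  by rewrite big_nil; under eq_fun do rewrite big_nil; exact: has_qintegral0.
by rewrite big_cons; under eq_fun do rewrite big_cons; exact: has_qintegralD.
Qed.

Lemma has_qintegralMl p f q : has_qintegral f q ->
  has_qintegral (fun z => p * f z) (p * q).
Proof.
move=> [f0 f1 f2 f3]; rewrite quat_mulE; split;
  under eq_fun do rewrite quat_mulE /=.
all: repeat first [exact: has_integralZ | apply: has_integralB |
  apply: has_integralD].
Qed.

Lemma has_qintegralMr p f q : has_qintegral f q ->
  has_qintegral (fun z => f z * p) (q * p).
Proof.
move=> [f0 f1 f2 f3]; rewrite quat_mulE; split;
  under eq_fun do rewrite quat_mulE /=.
all: repeat first [exact: has_integralZr | apply: has_integralB |
  apply: has_integralD].
Qed.

Lemma has_qintegralZ t f q : has_qintegral f q ->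
  has_qintegral (fun z => t *: f z) (t *: q).
Proof. by move=> [? ? ? ?]; split; exact: has_integralZ. Qed.

End QuaternionMeans.

(** * Orthogonal polynomials *)

Section OrthogonalPolynomials.
Context {R : realType}.
Implicit Types (q : quat R) (z : R * R * R).

Definition pureq_moment k : R :=
  if odd k then 0 else (-1) ^+ k./2 * rising2 3 k./2.

Lemma pureq_moment_double m : pureq_moment m.*2 = (-1) ^+ m * rising2 3 m.
Proof. by rewrite /pureq_moment odd_double doubleK. Qed.

(** Even powers are real because z^2 = -|z|^2; in odd powers each imaginary component is a
    coordinate times a power of |z|^2, whose mean is zero. *)
Lemma has_qintegral_pureqX k :
  has_qintegral (fun z => pureq z ^+ k) (pureq_moment k *: (1 : quat R)).
Proof.
rewrite -[k]odd_double_half; case: (odd k) => /=; last first.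
  rewrite add0n pureq_moment_double.
  under eq_fun do rewrite pureqX_double.
  have H := has_integralZ ((-1) ^+ k./2) (@has_integral_gauss3_norm R k./2).
  split => /=; first by (under eq_fun do rewrite mulr1); rewrite mulr1.
  - by rewrite mulr0; under eq_fun do rewrite mulr0; exact: has_integral0.
  - by rewrite mulr0; under eq_fun do rewrite mulr0; exact: has_integral0.
  - by rewrite mulr0; under eq_fun do rewrite mulr0; exact: has_integral0.
rewrite /pureq_moment add1n /= odd_double /= scale0r.
under eq_fun do rewrite pureqX_doubleS.
have H a b c := @has_integral_gauss3_odd R a b c k./2.
split => /=.
- by under eq_fun do rewrite mulr0; exact: has_integral0.
- have := has_integralZ ((-1) ^+ k./2) (H 1 0 0 isT).
  by rewrite mulr0; under eq_fun do rewrite !expr0 expr1 !mulr1 mulrCA mulrC.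
- have := has_integralZ ((-1) ^+ k./2) (H 0 1 0 isT).
  by rewrite mulr0; under eq_fun do rewrite !expr0 expr1 mul1r !mulr1 mulrCA
    mulrC.
- have := has_integralZ ((-1) ^+ k./2) (H 0 0 1 isT).
  by rewrite mulr0; under eq_fun do rewrite !expr0 expr1 !mul1r mulrCA mulrC.
Qed.

(** The coefficients of the generalised Hermite polynomials for s^2 exp(-s^2/2), the radial weight
    in R^3. They enter with a plus sign because z^2 = -|z|^2. *)
Definition rec_coef n : R := if odd n then n.+2%:R else n%:R.

Fixpoint orth_poly n q : quat R :=
  match n with
  | 0 => 1
  | n'.+1 => match n' with
             | 0 => q
             | m.+1 => q * orth_poly n' q + rec_coef n' *: orth_poly m q
             end
  end.

(* The mean of [z ^+ k * orth_poly n z]. *)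
Fixpoint orth_moment n k : R :=
  match n with
  | 0 => pureq_moment k
  | n'.+1 => match n' with
             | 0 => pureq_moment k.+1
             | m.+1 => orth_moment n' k.+1 + rec_coef n' * orth_moment m k
             end
  end.

Lemma orth_polySS n q : orth_poly n.+2 q =
  q * orth_poly n.+1 q + rec_coef n.+1 *: orth_poly n q.
Proof. by []. Qed.

Lemma orth_momentSS n k : orth_moment n.+2 k =
  orth_moment n.+1 k.+1 + rec_coef n.+1 * orth_moment n k.
Proof. by []. Qed.

Lemma two_step_ind (P : nat -> Prop) :
  P 0 -> P 1 -> (forall n, P n -> P n.+1 -> P n.+2) -> forall n, P n.
Proof.
by move=> P0 P1 PS n; suff [] : P n /\ P n.+1 by []; elim: n => [|n []]; split;
  auto.
Qed.

Lemma has_qintegral_orth_moment n k :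
  has_qintegral (fun z => pureq z ^+ k * orth_poly n (pureq z))
    (orth_moment n k *: (1 : quat R)).
Proof.
elim/two_step_ind: n k => [|| n IH0 IH1] k.
- by under eq_fun do rewrite /= mulr1; exact: has_qintegral_pureqX.
- by under eq_fun do rewrite /= -exprSr; exact: has_qintegral_pureqX.
rewrite orth_momentSS scalerDl -scalerA.
under eq_fun do rewrite orth_polySS mulrDr qscaleAr mulrA -exprSr.
exact: has_qintegralD (IH1 _) (has_qintegralZ _ (IH0 _)).
Qed.

(* [m - j] is truncated, but [m ^_ j = 0] when [m < j]. *)
Lemma ffactn_subr m j : (m ^_ j * (m - j))%:R = (m ^_ j)%:R * (m%:R - j%:R) :> R.
Proof.
have [mj|jm] := ltnP m j; first by rewrite ffact_small// !mul0r.
by rewrite natrM natrB.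
Qed.

(** Both parities are proved in one induction on [j], since the recurrence links each to the
    other. *)
Lemma orth_moment_closed j m :
  orth_moment j.*2 m.*2 =
    (-1) ^+ (m + j) * rising2 3 m * 2 ^+ j * (m ^_ j)%:R /\
  orth_moment j.*2.+1 m.*2.+1 =
    - (-1) ^+ (m + j) * rising2 3 m.+1 * 2 ^+ j * (m ^_ j)%:R.
Proof.
have nD a n : (a + n.*2)%:R = a%:R + 2 * n%:R :> R.
  by rewrite natrD -mul2n natrM.
have natrS n : n.+1%:R = n%:R + 1 :> R by rewrite -addn1 natrD.
elim: j m => [|j IHj] m.
  rewrite /= addn0 ffactn0 !mulr1 pureq_moment_double -doubleS
    pureq_moment_double.
  by rewrite exprS mulN1r.
(* Proved for every [k], because the odd case at [m] uses it at [m.+1]. *)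
have E k : orth_moment j.+1.*2 k.*2 =
    (-1) ^+ (k + j.+1) * rising2 3 k * 2 ^+ j.+1 * (k ^_ j.+1)%:R.
  rewrite doubleS orth_momentSS (IHj k).1 (IHj k).2 /rec_coef /= odd_double /=.
  rewrite ffactnSr ffactn_subr rising2S addnS !exprS.
  rewrite (_ : j.*2.+3 = 3 + j.*2)%N // !nD.
  move: ((-1) ^+ (k + j)) (rising2 3 k) (2 ^+ j) (k ^_ j)%:R k%:R j%:R.
  by move=> a b c d e f; ring.
split; first exact: E.
rewrite doubleS orth_momentSS -!doubleS E (IHj m).2 /rec_coef /= odd_double /=.
rewrite ffactSS addSn addnS !exprS natrM.
rewrite -[j.+1.*2]add0n nD ffactnSr ffactn_subr (natrS m) (natrS j).
move: ((-1) ^+ (m + j)) (rising2 3 m.+1) (2 ^+ j) (m ^_ j)%:R m%:R j%:R.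
by move=> a b c d e f; ring.
Qed.

Lemma orth_moment_odd n k : odd (n + k) -> orth_moment n k = 0.
Proof.
elim/two_step_ind: n k => [|| n IH0 IH1] k /=.
- by rewrite /pureq_moment => ->.
- by rewrite /pureq_moment /= => ->.
by rewrite !negbK => nk; rewrite -/(orth_moment n.+1 k.+1) IH0// IH1 ?addnS/=
  ?negbK// mulr0 addr0.
Qed.

(** For indices of different parity the mean vanishes by parity; for equal parity the falling
    factorial in the closed form does. *)
Lemma orth_moment_lt n k : (k < n)%N -> orth_moment n k = 0.
Proof.
rewrite -(odd_double_half n) -(odd_double_half k).
case: (odd n); case: (odd k); rewrite ?add1n ?add0n => kn.
- rewrite (orth_moment_closed _ _).2 ffact_small ?mulr0//.
  by move: kn; rewrite ltnS ltn_double.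
- by rewrite orth_moment_odd// oddD /= !odd_double.
- by rewrite orth_moment_odd// oddD /= !odd_double.
- rewrite (orth_moment_closed _ _).1 ffact_small ?mulr0//.
  by move: kn; rewrite ltn_double.
Qed.

(** On the diagonal the falling factorial is a factorial. *)
Lemma orth_moment_neq0 n : orth_moment n n != 0.
Proof.
rewrite -[n]odd_double_half; case: (odd n); rewrite ?add1n ?add0n.
  rewrite (orth_moment_closed _ _).2 !mulf_neq0 ?oppr_eq0 ?signr_eq0
    ?rising2_neq0 ?expf_neq0//.
  by rewrite pnatr_eq0 -lt0n ffact_gt0.
rewrite (orth_moment_closed _ _).1 !mulf_neq0 ?signr_eq0 ?rising2_neq0
  ?expf_neq0//.
by rewrite pnatr_eq0 -lt0n ffact_gt0.
Qed.

(** The recurrence has real coefficients, so only powers of [q] with real factors occur. *)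
Lemma orth_polyC n q : q * orth_poly n q = orth_poly n q * q.
Proof.
elim/two_step_ind: n => [|| n IH0 IH1]; rewrite ?mulr1 ?mul1r//.
by rewrite orth_polySS mulrDr mulrDl qscaleAr qscaleAl -mulrA -IH1 IH0.
Qed.

(** Conjugation acts on z^k as the sign (-1)^k, and the exponents in [orth_poly n] all have the
    parity of [n]. *)
Lemma qconj_orth_poly n z :
  qconj (orth_poly n (pureq z)) = (-1) ^+ n *: orth_poly n (pureq z).
Proof.
elim/two_step_ind: n => [|| n IH0 IH1].
- by rewrite /= qconj1 scale1r.
- by rewrite /= qconj_pureq expr1 scaleN1r.
rewrite orth_polySS qconjD qconjM qconjZ IH0 IH1 qconj_pureq qscaleAl.
rewrite mulrN -orth_polyC scalerDr !scalerA; congr (_ + _).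
  by rewrite scalerN -scaleNr [in RHS]exprS mulN1r.
by congr (_ *: _); rewrite !exprS !mulN1r opprK mulrC.
Qed.

Definition qpoly_lt n (f : R * R * R -> quat R) :=
  exists a : nat -> quat R, forall z, f z = \sum_(k < n) pureq z ^+ k * a k.

Lemma qpoly_ltD n f g : qpoly_lt n f -> qpoly_lt n g ->
  qpoly_lt n (fun z => f z + g z).
Proof.
move=> [a fa] [b gb]; exists (fun k => a k + b k) => z.
by rewrite fa gb -big_split; apply: eq_bigr => k _; rewrite mulrDr.
Qed.

Lemma qpoly_ltZ n t f : qpoly_lt n f -> qpoly_lt n (fun z => t *: f z).
Proof.
move=> [a fa]; exists (fun k => t *: a k) => z.
by rewrite fa scaler_sumr; apply: eq_bigr => k _; rewrite qscaleAr.
Qed.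

Lemma qpoly_ltS n f : qpoly_lt n f -> qpoly_lt n.+1 f.
Proof.
(* The given coefficients are arbitrary from index [n] on, so they are cut off there. *)
move=> [a fa]; exists (fun k => if (k < n)%N then a k else 0) => z.
rewrite fa big_ord_recr /= ltnn mulr0 addr0.
by apply: eq_bigr => k _; rewrite ltn_ord.
Qed.

Lemma qpoly_ltM n f : qpoly_lt n f -> qpoly_lt n.+1 (fun z => pureq z * f z).
Proof.
move=> [a fa]; exists (fun k => if k is k'.+1 then a k' else 0) => z.
rewrite fa big_ord_recl /= mulr0 add0r mulr_sumr.
by apply: eq_bigr => k _; rewrite mulrA -exprS.
Qed.

Lemma qpoly_ltX n : qpoly_lt n.+1 (fun z => pureq z ^+ n).
Proof.
exists (fun k => if k == n then 1 else 0) => z.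
rewrite big_ord_recr /= eqxx mulr1 big1 ?add0r// => k _.
by rewrite ltn_eqF ?mulr0.
Qed.

Lemma orth_poly_monic n :
  qpoly_lt n (fun z => orth_poly n (pureq z) - pureq z ^+ n).
Proof.
elim/two_step_ind: n => [|| n IH0 IH1].
- by exists (fun=> 0) => z; rewrite big_ord0 /= subrr.
- by exists (fun=> 0) => z; rewrite big_ord1 /= expr1 subrr mulr0.
have H : qpoly_lt n.+1 (fun z => orth_poly n (pureq z)).
  have := qpoly_ltD (qpoly_ltS IH0) (qpoly_ltX n).
  by under eq_fun do rewrite subrK.
have := qpoly_ltD (qpoly_ltM IH1) (qpoly_ltS (qpoly_ltZ (rec_coef n.+1) H)).
congr qpoly_lt; apply/funext => z.
by rewrite orth_polySS mulrBr -exprS addrAC.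
Qed.

End OrthogonalPolynomials.

(** * Orthogonality, uniqueness and the Hermite form *)

Section Uniqueness.
Context {R : realType}.
Implicit Types (z : R * R * R).

Lemma has_qintegral_monomial_orth n k (a : quat R) :
  has_qintegral (fun z => qconj (pureq z ^+ k * a) * orth_poly n (pureq z))
    (((-1) ^+ k * orth_moment n k) *: qconj a).
Proof.
have := has_qintegralMl (qconj a)
  (has_qintegralZ ((-1) ^+ k) (@has_qintegral_orth_moment R n k)).
rewrite scalerA qscaleAr mulr1.
by under eq_fun do rewrite -qscaleAl -qconj_pureqX mulrA -qconjM.
Qed.

(** The conjugate is a sign times [orth_poly n], which commutes with powers of z; the coefficient
    then leaves the integral on the right. *)
Lemma has_qintegral_orth_monomial n k (a : quat R) :
  has_qintegral (fun z => qconj (orth_poly n (pureq z)) * (pureq z ^+ k * a))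
    (((-1) ^+ n * orth_moment n k) *: a).
Proof.
have C z : GRing.comm (pureq z ^+ k) (orth_poly n (pureq z)).
  by apply/commr_sym/commrX/commr_sym; exact: orth_polyC.
have := has_qintegralMr a
  (has_qintegralZ ((-1) ^+ n) (@has_qintegral_orth_moment R n k)).
rewrite scalerA qscaleAl mul1r.
by under eq_fun do rewrite C -qscaleAl -qconj_orth_poly -mulrA.
Qed.

Lemma has_qintegral_orth_poly_lt k n : (k < n)%N ->
  has_qintegral (fun z => qconj (orth_poly k (pureq z)) * orth_poly n (pureq z))
    (0 : quat R).
Proof.
move=> kn; have [a Qk] := @orth_poly_monic R k.
(* Only the factor of lower degree is expanded, with leading coefficient 1 at i = k; all its
   exponents stay below [n]. *)
have E z : qconj (orth_poly k (pureq z)) * orth_poly n (pureq z) =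
    \sum_(i < k.+1) qconj (pureq z ^+ i * (if (i < k)%N then a i else 1)) *
      orth_poly n (pureq z).
  rewrite big_ord_recr /= ltnn mulr1 -mulr_suml -mulrDl.
  congr (_ * _); rewrite -[orth_poly k _](subrK (pureq z ^+ k)) Qk qconjD.
  congr (_ + _); rewrite (big_morph qconj (@qconjD R) (_ : qconj 0 = 0)).
    by apply: eq_bigr => i _; rewrite ltn_ord.
  by apply: quat_eqP; rewrite /= ?oppr0.
under eq_fun do rewrite E.
rewrite [X in has_qintegral _ X](_ : _ = \sum_(i < k.+1)
  ((-1) ^+ i * orth_moment n i) *: qconj (if (i < k)%N then a i else 1)).
  by apply: has_qintegral_sum => i; exact: has_qintegral_monomial_orth.
rewrite big1// => i _; rewrite orth_moment_lt ?mulr0 ?scale0r//.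
exact: leq_ltn_trans (leq_ord i) kn.
Qed.

(** Strong induction. The difference in degree [n] has lower degree, and orthogonality to the
    earlier, already identified polynomials gives a triangular linear system for its coefficients
    [d]. *)
Lemma orth_poly_unique (P : nat -> R * R * R -> quat R) :
  monic_orthogonal_system P -> forall n z, P n z = orth_poly n (pureq z).
Proof.
move=> [monicP orthP]; elim/ltn_ind => n IHn.
have [d dE] : qpoly_lt n (fun z => P n z - orth_poly n (pureq z)).
  have [a Pn] := monicP n.
  have [b bE] := qpoly_ltZ (-1) (@orth_poly_monic R n).
  exists (fun k => a k + b k) => z; rewrite Pn.
  under [RHS]eq_bigr do rewrite mulrDr.
  by rewrite big_split -bE /= scaleN1r opprB; rewrite [in LHS]addrAC addrC.
have PnE z : P n z = orth_poly n (pureq z) + \sum_(j < n) pureq z ^+ j * d j.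
  by rewrite -dE addrC subrK.
have ip k : (k < n)%N -> \sum_(j < n) orth_moment k j *: d j = 0.
  move=> kn; have := orthP k n (negP (negbT (ltn_eqF kn)) \o introT eqP).
  have H := has_qintegralD (has_qintegral_orth_poly_lt kn)
    (has_qintegral_sum (fun j : 'I_n => has_qintegral_orth_monomial k j (d j))).
  rewrite /qdot (_ : (fun z => _) = fun z => qconj (orth_poly k (pureq z)) *
      orth_poly n (pureq z) + \sum_(j < n) qconj (orth_poly k (pureq z)) *
      (pureq z ^+ j * d j)); last first.
    by apply/funext => z; rewrite (IHn _ kn) PnE mulrDr mulr_sumr.
  rewrite (has_qintegralE H) add0r.
  under eq_bigr do rewrite -scalerA.
  rewrite -scaler_sumr => /(congr1 ( *:%R ((-1) ^+ k))).
  by rewrite scalerA -exprMn mulrNN mulr1 expr1n scale1r scaler0.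
(* [orth_moment k j = 0] for [j < k], so the coefficients vanish from the top
  down. *)
have d0 i k : (k < n)%N -> (n - k <= i)%N -> d k = 0.
  elim: i k => [|i IHi] k kn ki; first by move: ki;
    rewrite leqn0 subn_eq0 leqNgt kn.
  have := ip k kn; rewrite (bigD1 (Ordinal kn))//= big1 => [|j jk].
    rewrite addr0 => /(congr1 ( *:%R (orth_moment k k)^-1)).
    by rewrite scalerA mulVf ?orth_moment_neq0// scale1r scaler0.
  have [jk'|kj] := ltnP j k; first by rewrite orth_moment_lt ?scale0r//.
  rewrite (IHi j) ?scaler0//.
  have {}kj : (k < j)%N by rewrite ltn_neqAle kj andbT; move: jk; rewrite eq_sym.
  by have := ltn_ord j; lia.
move=> z; rewrite PnE big1 ?addr0// => j _.
by rewrite (d0 n) ?mulr0// leq_subr.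
Qed.

(** Since u^(n+2) = -u^n, both recurrences reduce to one scalar identity for each parity. *)
Lemma orth_poly_hermite n (s : R) (u : quat R) : s != 0 -> u * u = -1 ->
  orth_poly n (s *: u) =
    if odd n
    then (s ^- 2 * (s * (hermite R n.+1).[s] + (hermite R n).[s])) *: u ^+ n
    else (s^-1 * (hermite R n.+1).[s]) *: u ^+ n.
Proof.
move=> s0 uu.
have hSS m : (hermite R m.+2).[s] =
    s * (hermite R m.+1).[s] - m.+1%:R * (hermite R m).[s].
  by rewrite [hermite R _.+2]/= !hornerE.
have uSS m : u ^+ m.+2 = - u ^+ m by rewrite !exprS mulrA uu mulN1r.
elim/two_step_ind: n => [|| n IH0 IH1].
- by rewrite /= hornerX mulVf// scale1r expr0.
- rewrite /= expr1 !hornerE; congr (_ *: _); by field.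
rewrite orth_polySS IH0 IH1 (hSS n.+1) (hSS n).
(* The higher Hermite values are eliminated; what remains is linear in these two, with coefficients
   rational in s. *)
move: (hermite R n.+1).[s] (hermite R n).[s] => a b.
rewrite /rec_coef /= negbK qscaleAl.
case: (odd n) => /=; rewrite qscaleAr -exprS !uSS !scalerA !scalerN -!(scaleNr
  _ (u ^+ n)) -scalerDl;
  congr (_ *: _); rewrite -!natr1; by field.
Qed.

End Uniqueness.

Theorem mainTheorem5 (R : realType) (P : nat -> R * R * R -> quat R)
  (hP : monic_orthogonal_system P)
  (x : R * R * R) (hx : pureq x <> 0) (n : nat) :
  let s : R := qabs (pureq x) in
  let u : quat R := s^-1 *: pureq x in
  P n x =
    if odd n
    then (s ^- 2 * (s * (hermite R n.+1).[s] + (hermite R n).[s])) *: u ^+ n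
    else (s^-1 * (hermite R n.+1).[s]) *: u ^+ n.
Proof.
move=> s u.
have ss : s ^+ 2 = x.1.1 ^+ 2 + x.1.2 ^+ 2 + x.2 ^+ 2.
  rewrite /s /qabs /= expr0n add0r sqr_sqrtr//.
  by rewrite !addr_ge0 ?sqr_ge0.
have s0 : s != 0.
  apply/eqP => s0; apply: hx; move: ss; rewrite s0 expr0n => /esym/eqP.
  rewrite !paddr_eq0 ?addr_ge0 ?sqr_ge0// !sqrf_eq0 => /andP[/andP[/eqP xi /eqP
    xj] /eqP xk].
  by apply: quat_eqP.
(* The square of x is -|x|^2 = -s^2, and u is x divided by s. *)
have uu : u * u = -1.
  rewrite /u qscaleAl qscaleAr scalerA -[pureq x * _]expr2 pureqX2 -ss scalerA.
  by rewrite mulrN -expr2 -exprMn mulVf// expr1n scaleN1r.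
rewrite (orth_poly_unique hP).
rewrite (_ : pureq x = s *: u) ?(orth_poly_hermite n s0 uu)//.
by rewrite /u scalerA mulfV// scale1r.
Qed.
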